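(* If $f\in F_n^{\nearrow}$ is the nom code of the permutation $\sigma\in\mathfrak{S}_n$ (i.e. $\phi(f)=\sigma$), then $\mathrm{Flip}(f)$ is the nom code of the permutation $\tau=((\sigma^{-1})^{r})^{c}$.
   Context: $[n]=\{1,\dots,n\}$, $\mathfrak{S}_n$ the symmetric group on $[n]$; products of permutations are composed with the leftmost factor acting first: $(\alpha\beta)(x)=\beta(\alpha(x))$. A function $f:[n]\to[n]$ is subexceedant if $1\le f(i)\le i$ for all $i$, written $f_1\cdots f_n$; $F_n$ is the set of such functions and $F_n^{\nearrow}$ the non-decreasing ones. $\phi:F_n\to\mathfrak{S}_n$, $\phi(f)=(1,f_1)(2,f_2)\cdots(n,f_n)$ (with $(i,i)$ the identity), is a bijection; $\phi^{-1}(\sigma)$ is the nom code of $\sigma$. For $f\in F_n^{\nearrow}$ with $r_k=|\{i:f_i=k\}|$, $\mathrm{Flip}(f)=f'_1\cdots f'_n$ with $f'_i=n+1-\sum_{k=1}^{n-i+1}r_k$. For $\pi\in\mathfrak{S}_n$, the reverse is $\pi^r(i)=\pi(n+1-i)$ and the complement is $\pi^c(i)=n+1-\pi(i)$. *)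

(* Defs.v *)
From mathcomp Require Import all_boot all_fingroup.

Set Implicit Arguments.
Unset Strict Implicit.
Unset Printing Implicit Defensive.

Local Open Scope group_scope.

(* [n] = {1, ..., n} is 'I_n with positions and values both shifted down by   *)
(* one: i : 'I_n stands for i + 1.  Permutations multiply as                  *)
(* (s * t) x = t (s x), leftmost factor acting first (permM).                 *)

Definition subexceedant (n : nat) : {set {ffun 'I_n -> 'I_n}} :=
  [set f : {ffun 'I_n -> 'I_n} | [forall i, f i <= i]].

Definition subexceedant_nondecr (n : nat) : {set {ffun 'I_n -> 'I_n}} :=
  [set f in subexceedant n |
    [forall i : 'I_n, forall j : 'I_n, (i <= j) ==> (f i <= f j)]].

(* The factors appear in increasing order of i; tperm i i = 1. *)
Definition phi (n : nat) (f : {ffun 'I_n -> 'I_n}) : 'S_n :=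
  \prod_(i < n) tperm i (f i).

Definition is_nom_code (n : nat) (f : {ffun 'I_n -> 'I_n}) (s : 'S_n) : Prop :=
  f \in subexceedant n /\ phi f = s.

Definition fiber_card (n : nat) (f : {ffun 'I_n -> 'I_n}) (k : 'I_n) : nat :=
  #|[set i | f i == k]|.

(* With i = j + 1, the value f'_i - 1 is n - \sum_(k = 1)^(n - j) r_k. *)
Definition flip_val (n : nat) (f : {ffun 'I_n -> 'I_n}) (j : 'I_n) : nat :=
  n - \sum_(k < n | k < n - j) fiber_card f k.

(* The default value j is never used for subexceedant f, see FlipE. *)
Definition Flip (n : nat) (f : {ffun 'I_n -> 'I_n}) : {ffun 'I_n -> 'I_n} :=
  [ffun j => insubd j (flip_val f j)].

Definition reverse (n : nat) (s : 'S_n) : 'S_n :=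
  perm (inj_comp (@perm_inj _ s) (@rev_ord_inj n)).

Definition complement (n : nat) (s : 'S_n) : 'S_n :=
  perm (inj_comp (@rev_ord_inj n) (@perm_inj _ s)).

Lemma reverseE n (s : 'S_n) i : reverse s i = s (rev_ord i).
Proof. by rewrite permE. Qed.

Lemma complementE n (s : 'S_n) i : complement s i = rev_ord (s i).
Proof. by rewrite permE. Qed.

Lemma sum_fiber_card_le n (f : {ffun 'I_n -> 'I_n}) (P : pred 'I_n) :
  \sum_(k < n | P k) fiber_card f k <= n.
Proof.
have n_sum : n = \sum_(k < n) fiber_card f k.
  rewrite -[LHS]card_ord -sum1_card [LHS](partition_big f predT) //=.
  by apply: eq_bigr => k _; rewrite /fiber_card -sum1dep_card.
by rewrite [leqRHS]n_sum [leqRHS](bigID P) leq_addr.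
Qed.

Lemma FlipE n (f : {ffun 'I_n -> 'I_n}) (j : 'I_n) :
  f \in subexceedant n ->
  (Flip f j + \sum_(k < n | k < n - j) fiber_card f k = n)%N.
Proof.
case: n f j => [|n] f j; first by case: j.
rewrite inE => /forallP/(_ ord0); rewrite leqn0 => f0.
have S_gt0 : 0 < \sum_(k < n.+1 | k < n.+1 - j) fiber_card f k.
  rewrite (bigD1 ord0) ?subn_gt0 //= addn_gt0 /fiber_card.
  by apply/orP; left; apply/card_gt0P; exists ord0; rewrite inE.
rewrite ffunE val_insubd /flip_val ifT ?subnK ?sum_fiber_card_le //.
by rewrite ltn_subrL S_gt0.
Qed.

Lemma phi_inj n : {in subexceedant n &, injective (@phi n)}.
Proof.
pose p (f : {ffun 'I_n -> 'I_n}) m : 'S_n :=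
  \prod_(0 <= i < m) (if insub i is Some j then tperm j (f j) else 1).
have pS f (j : 'I_n) : p f j.+1 = p f j * tperm j (f j).
  by rewrite /p big_nat_recr //= valK.
have pfix f m (x : 'I_n) : f \in subexceedant n -> m <= x -> p f m x = x.
  rewrite inE => /forallP fle; elim: m => [|m IHm] lt_mx.
    by rewrite /p big_geq // perm1.
  have lt_mn := ltn_trans lt_mx (ltn_ord x).
  rewrite -[m]/(val (Ordinal lt_mn)) pS permM IHm ?(ltnW lt_mx) // tpermD //.
    by rewrite -val_eqE neq_ltn lt_mx.
  by rewrite -val_eqE neq_ltn (leq_ltn_trans (fle (Ordinal lt_mn))).
have phiE f : phi f = p f n.
  by rewrite /p big_mkord; apply: eq_bigr => i _; rewrite valK.
move=> f g fF gF; rewrite !phiE => eq_fg.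
suff H m : m <= n -> p f m = p g m -> forall i : 'I_n, i < m -> f i = g i.
  by apply/ffunP => i; apply: (H n).
elim: m => // m IHm lt_mn; rewrite -[m]/(val (Ordinal lt_mn)) !pS => eq_p.
have eq_m : f (Ordinal lt_mn) = g (Ordinal lt_mn).
  move/permP/(_ (Ordinal lt_mn)): (eq_p).
  by rewrite !permM !pfix // !tpermL.
move: eq_p; rewrite eq_m => /mulIg eq_p i.
rewrite ltnS leq_eqVlt => /orP[/eqP/val_inj -> // | ].
exact: (IHm (ltnW lt_mn)).
Qed.

Lemma card_subexceedant n : #|subexceedant n| = n`!.
Proof.
pose F (i : 'I_n) := [pred x : 'I_n | x <= i].
have -> : #|subexceedant n| = #|(family F : simpl_pred {ffun 'I_n -> 'I_n})|.
  by apply: eq_card => f; rewrite inE; apply/forallP/familyP => H i; apply: H.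
rewrite card_family foldrE big_map big_enum /=.
rewrite fact_prod big_add1 big_mkord; apply: eq_bigr => i _.
have widen_inj : injective (widen_ord (ltn_ord i)).
  by move=> x y /(congr1 val) /= /val_inj.
rewrite -[RHS]card_ord -(card_imset _ widen_inj).
apply: eq_card => x; rewrite /in_mem /=; apply/idP/imsetP => [le_xi | [y _ ->]].
  by exists (Ordinal (le_xi : x < i.+1)) => //; apply: val_inj.
exact: (ltn_ord y).
Qed.

Lemma nom_code_exists_unique n (s : 'S_n) : exists! f, is_nom_code f s.
Proof.
have /setP/(_ s) : (@phi n) @: subexceedant n = setT.
  apply/eqP; rewrite eqEcard subsetT cardsT card_Sn.
  by rewrite (card_in_imset (@phi_inj n)) card_subexceedant leqnn.
rewrite in_setT => /imsetP[f fF ->]; exists f; split=> // g [gF eq_gf].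
exact: phi_inj.
Qed.

(* Main.v *)
(** Conjugating [sigma^-1] by the order reversal turns [phi f] into the product
    of the transpositions [(i, h i)], [i] increasing, where
    [h i = rev (f (rev i))] is non-decreasing with [i <= h i], and [Flip f] is
    the generalised inverse [j |-> min {i | j <= h i}] of [h].  The two products
    [\prod (i, h i)] and [\prod (j, Flip f j)] agree because the cycle
    [a -> a + 1 -> ... -> c - 1 -> a] is both [(a, c-1)(a+1, c-1)...(c-2, c-1)]
    and [(a+1, a)(a+2, a)...(c-1, a)], which lets one pass between the two along
    the steps of the graph of [h]. *)
Require Import Defs.
From mathcomp Require Import all_boot all_fingroup zify.

Set Implicit Arguments.
Unset Strict Implicit.
Unset Printing Implicit Defensive.

Local Open Scope group_scope.

(** Inversion reverses the factors; the index [m - i.+1], later absorbed by [rev_ord], keeps [i]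
    increasing. *)
Lemma prodgV_nat (gT : finGroupType) (m : nat) (s : nat -> gT) :
  (\prod_(0 <= i < m) s i)^-1 = \prod_(0 <= i < m) (s (m - i.+1))^-1.
Proof.
elim: m => [|m IHm]; first by rewrite !big_geq // invg1.
by rewrite big_nat_recr //= invMg IHm big_nat_recl //= subn1.
Qed.

Section TranspositionProducts.

Variables (T : finType) (x : nat -> T) (n : nat).
Hypothesis x_inj : {in gtn n &, injective x}.

Let x_neq j k : j < k -> k < n -> x j != x k.
Proof.
move=> lt_jk lt_kn; apply/eqP => /x_inj; rewrite !inE lt_kn.
move=> /(_ (ltn_trans lt_jk lt_kn) isT) eq_jk.
by rewrite eq_jk ltnn in lt_jk.
Qed.

(** Every factor but the last fixes [x c.-1], and the last one sends it to [x a]. *)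
Lemma prod_tperm_first_last a c : a < c -> c <= n ->
  (\prod_(a <= j < c) tperm (x j) (x a)) (x c.-1) = x a.
Proof.
case: c => // c le_ac lt_cn; rewrite big_nat_recr //= permM.
have [<-|ne_ac] := eqVneq a c; first by rewrite big_geq // perm1 tpermL.
suff -> : (\prod_(a <= j < c) tperm (x j) (x a)) (x c) = x c by rewrite tpermL.
have lt_ac : a < c by rewrite ltn_neqAle ne_ac.
rewrite big_nat; elim/big_rec: _ => [|j s /andP[_ lt_jc] fix_s].
  by rewrite perm1.
by rewrite permM tpermD ?x_neq.
Qed.

Lemma prod_tperm_last_first a c : a <= c -> c <= n ->
  \prod_(a <= i < c) tperm (x i) (x c.-1)
    = \prod_(a <= j < c) tperm (x j) (x a).
Proof.
move=> le_ac le_cn; rewrite -(subKn le_ac).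
have: c - a <= c by rewrite leq_subr.
elim: {a le_ac}(c - a) => [|d IHd] lt_dc; first by rewrite subn0 !big_geq.
have := IHd (ltnW lt_dc); have <-: (c - d.+1).+1 = c - d by rewrite subnSK.
have : c - d.+1 < c by rewrite ltn_subrL (leq_trans _ lt_dc).
move: (c - d.+1) => a {IHd d lt_dc} lt_ac IH.
rewrite big_ltn // IH [RHS]big_ltn // tperm1 mul1g.
have [le_ca|lt_a1c] := leqP c a.+1.
  have -> : c = a.+1 by apply/eqP; rewrite eqn_leq le_ca.
  by rewrite !big_geq // tperm1 mulg1.
have lt_a1n := leq_trans lt_a1c le_cn.
have fix_a : (\prod_(a.+1 <= j < c) tperm (x j) (x a.+1)) (x a) = x a.
  rewrite big_nat; elim/big_rec: _ => [|j s /andP[lt_aj lt_jc] fix_s].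
    by rewrite perm1.
  by rewrite permM tpermD // eq_sym x_neq // (leq_trans lt_jc).
(* Moved right past the cycle, [(x a, x c.-1)] becomes [(x a, x a.+1)]. Moved back to the front, the
   latter turns [x a.+1] into [x a] in every remaining factor. *)
rewrite conjgC tpermJ fix_a prod_tperm_first_last //.
rewrite [X in X * _]big_ltn // tperm1 mul1g conjgC [RHS]big_ltn // tpermC.
congr (_ * _).
rewrite (big_morph (conjg^~ _) (fun u v => conjMg u v _) (conj1g _)).
apply: eq_big_nat => j /andP[lt_aj lt_jc].
have lt_jn := leq_trans lt_jc le_cn.
by rewrite tpermJ tpermL tpermD // x_neq // ltnW.
Qed.

(* Here [c i.+1] stands for [h i + 1].  The correcting second factor depends only
   on [m] and [c m], which makes the induction on [m] go through; it is empty for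
   [m = n], where [c n = n]. *)
Lemma prod_tperm_staircase (c F : nat -> nat) m :
  c 0 = 0 -> (forall i, i <= n -> i <= c i <= n) ->
  (forall i, i < n -> c i <= c i.+1) ->
  (forall i j, i < n -> c i <= j < c i.+1 -> F j = i) ->
  m <= n ->
  (\prod_(0 <= i < m) tperm (x i) (x (c i.+1).-1)) *
    (\prod_(m <= i < c m) tperm (x i) (x (c m).-1))
    = \prod_(0 <= j < c m) tperm (x j) (x (F j)).
Proof.
move=> c0 c_bnd c_mono FE; elim: m => [|m IHm] lt_mn.
  by rewrite c0 !big_geq // mulg1.
have /andP[le_mc le_cn] := c_bnd m (ltnW lt_mn).
have /andP[lt_mc' le_c'n] := c_bnd m.+1 lt_mn.
rewrite (big_cat_nat (leq0n _) (c_mono m lt_mn)) /= -(IHm (ltnW lt_mn)).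
rewrite big_nat_recr //= -!mulgA; congr (_ * _).
(* The new factor joins the correcting product, which now starts at [m]; rewritten with common point
   [x m], it can be split at [c m]. *)
rewrite -big_ltn // !prod_tperm_last_first ?(ltnW lt_mc') //.
rewrite (big_cat_nat le_mc (c_mono m lt_mn)) /=; congr (_ * _).
by apply: eq_big_nat => j /FE->.
Qed.

End TranspositionProducts.

(** The order reversal is an involution, so composing with it on both sides is a conjugation. *)
Lemma complement_reverseE (n : nat) (s : 'S_n) :
  complement (reverse s) = s ^ perm (@rev_ord_inj n).
Proof.
have rV : (perm (@rev_ord_inj n))^-1 = perm (@rev_ord_inj n).
  apply/eqP; rewrite eq_invg_mul; apply/eqP/permP => i.
  by rewrite permM !permE rev_ordK.
apply/permP => i.
by rewrite complementE reverseE conjgE rV !permM !permE.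
Qed.

Lemma card_ord_lt (n m : nat) : m <= n -> #|[set p : 'I_n | p < m]| = m.
Proof.
move=> le_mn; rewrite -sum1dep_card (big_ord_narrow le_mn).
by rewrite sum1_card card_ord.
Qed.

Lemma sum_fiber_card (n m : nat) (f : {ffun 'I_n -> 'I_n}) :
  \sum_(k < n | k < m) fiber_card f k = #|[set p | f p < m]|.
Proof.
rewrite -sum1dep_card [RHS](partition_big f (fun k : 'I_n => k < m)) //=.
apply: eq_bigr => k lt_km; rewrite /fiber_card -sum1dep_card.
by apply: eq_bigl => p; case: eqP => [->|]; rewrite ?lt_km ?andbF.
Qed.

(** As [f p <= p], the sublevel set counted by [Flip] at [j] contains the first [n - j] points. *)
Lemma Flip_subexceedant (n : nat) (f : {ffun 'I_n -> 'I_n}) :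
  f \in subexceedant n -> Flip f \in subexceedant n.
Proof.
move=> f_sub; have f_le i : f i <= i by move: f_sub; rewrite inE => /forallP.
rewrite inE; apply/forallP => j.
have := FlipE j f_sub; rewrite sum_fiber_card => FE.
have le_nj_card : n - j <= #|[set p | f p < n - j]|.
  rewrite -[leqLHS](card_ord_lt (leq_subr j n)).
  apply/subset_leq_card/subsetP => p; rewrite !inE.
  exact: leq_ltn_trans (f_le p).
by have := ltn_ord j; lia.
Qed.

Theorem theorem5p2 (n : nat) (f : {ffun 'I_n -> 'I_n}) (sigma : 'S_n)
  (f_nondecr : f \in subexceedant_nondecr n)
  (f_code : is_nom_code f sigma) :
  is_nom_code (Flip f) (complement (reverse sigma^-1)).
Proof.
case: f_code => f_sub <- {sigma}; split; first exact: Flip_subexceedant.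
case: n f f_nondecr f_sub => [|n] f f_nondecr f_sub.
  by apply/permP => - [].
pose x : nat -> 'I_n.+1 := inord.
pose h i : 'I_n.+1 := rev_ord (f (rev_ord (x i))).
(* With [c 0 = 0], the blocks [c i <= j < c i.+1] tile all indices; [Flip f] equals [i] on the
   [i]-th one. *)
pose c i := if i is k.+1 then (h k).+1 else 0.
have x_inj : {in gtn n.+1 &, injective x}.
  by move=> i j lt_i lt_j /(congr1 val); rewrite /= !inordK.
have f_le i : f i <= i by move: f_sub; rewrite inE => /forallP.
have f_mono (i j : 'I_n.+1) : i <= j -> f i <= f j.
  by move: f_nondecr; rewrite inE => /andP[_ /'forall_forallP/(_ i j)/implyP].
have c_bnd i : i <= n.+1 -> i <= c i <= n.+1.
  case: i => // i lt_in; rewrite /c ltn_ord andbT ltnS /h /= subSS.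
  have := f_le (rev_ord (x i)); rewrite /= inordK // subSS => le_f.
  by rewrite -[leqLHS](subKn (lt_in : i <= n)) leq_sub2l.
have c_mono i : i < n.+1 -> c i <= c i.+1.
  case: i => // i lt_in; rewrite /c ltnS /h /= leq_sub2l // ltnS f_mono //=.
  by rewrite !inordK ?leq_sub2l // ltnW.
have FE i j : i < n.+1 -> c i <= j < c i.+1 -> val (Flip f (x j)) = i.
  move=> lt_in /andP[le_cj lt_jc].
  have lt_jn : j < n.+1 by rewrite (leq_trans lt_jc) ?ltn_ord.
  have := FlipE (x j) f_sub; rewrite sum_fiber_card inordK //.
  (* By monotonicity, [j <= h i] gives one inclusion and [h (i - 1) < j] the other; for [i = 0] the
     latter is trivial. *)
  suff -> : [set p | f p < n.+1 - j] = [set p : 'I_n.+1 | p < n.+1 - i].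
    by rewrite card_ord_lt ?leq_subr //=; lia.
  apply/setP => p; rewrite !inE; apply/idP/idP => [|lt_p].
    apply: contraLR; rewrite -!leqNgt => le_p.
    case: i lt_in le_cj le_p {lt_jc} => [|k] lt_kn.
      by have := ltn_ord p; lia.
    rewrite /c /h /= => lt_hj le_p.
    have : f (rev_ord (x k)) <= f p by rewrite f_mono //= inordK; lia.
    lia.
  have : f p <= f (rev_ord (x i)) by rewrite f_mono //= inordK; lia.
  by move: lt_jc (ltn_ord (f (rev_ord (x i)))); rewrite /c /h /=; lia.
have c_last : c n.+1 = n.+1.
  by apply/eqP; rewrite eqn_leq andbC; apply: c_bnd.
have := prod_tperm_staircase x_inj erefl c_bnd c_mono FE (leqnn n.+1).
rewrite c_last [X in _ * X]big_geq // mulg1 !big_mkord => eq_prod.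
rewrite complement_reverseE /phi.
have xE (i : 'I_n.+1) : x i = i by apply: inord_val.
rewrite (eq_bigr (fun i : 'I_n.+1 => tperm (x i) (x (Flip f (x i))))) => [|i _].
  rewrite -eq_prod.
  rewrite -(big_mkord xpredT (fun i => tperm (x i) (x (c i.+1).-1))).
  rewrite [X in X^-1](eq_bigr (fun i : 'I_n.+1 => tperm (x i) (f (x i)))).
    rewrite -(big_mkord xpredT (fun i => tperm (x i) (f (x i)))) prodgV_nat.
    (* Factor by factor, conjugation turns the transposition at [rev_ord (x i)] into
       [(x i, h i)]. *)
    rewrite (big_morph (conjg^~ _) (fun u v => conjMg u v _) (conj1g _)).
    apply: eq_big_nat => i /andP[_ lt_in].
    have -> : x (n.+1 - i.+1) = rev_ord (x i).
      by apply: val_inj; rewrite /= !inordK // subSS ltnS leq_subr.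
    by rewrite tpermV tpermJ !permE rev_ordK -/(h i) -[in RHS](xE (h i)).
  by move=> i _; rewrite xE.
by rewrite !xE.
Qed.
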